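(* Let $A,B,C$ be real matrices of sizes $n\times n$, $n\times r$, $l\times n$ with $\operatorname{rank}B=r$, let $(A,B)$ be controllable with controllability index $\nu$, and suppose $n=r\nu$. Let $N$, $T_1,\dots,T_\nu$ and $C_1,\dots,C_\nu$ be the matrices attached to $(A,B,C)$ by reduction to the block companion (Asseo) canonical form described in the context. Put $C(s)=C_1+C_2s+\cdots+C_\nu s^{\nu-1}$ (an $l\times r$ matrix polynomial) and $A_2^*(s)=T_\nu+T_{\nu-1}s+\cdots+T_1s^{\nu-1}+I_rs^\nu$ (an $r\times r$ monic matrix polynomial of degree $\nu$). Then the transfer function matrix $G(s)=C(sI_n-A)^{-1}B$ factorizes as $$G(s)=C(s)\,A_2^*(s)^{-1}.$$
   Context: The system is $\dot x=Ax+Bu$, $y=Cx$. The controllability index of $(A,B)$ is the smallest integer $\nu$ with $\operatorname{rank}[B,AB,\dots,A^{\nu-1}B]=\operatorname{rank}[B,AB,\dots,A^{n-1}B]$ $(=n)$. When $n=r\nu$, define the $r\times n$ matrix $N_\nu=[O,\dots,O,I_r]\,[B,AB,\dots,A^{\nu-1}B]^{-1}$ and let $N$ be the $n\times n$ matrix with block rows $N_\nu, N_\nu A,\dots,N_\nu A^{\nu-1}$ (from top to bottom). Then $N$ is nonsingular, $NB=\begin{bmatrix}O\\ I_r\end{bmatrix}$, and $A^*=NAN^{-1}$ is the block companion matrix $$A^*=\begin{bmatrix}O&I_r&O&\cdots&O\\O&O&I_r&\cdots&O\\ \vdots&&&\ddots&\vdots\\O&O&O&\cdots&I_r\\-T_\nu&-T_{\nu-1}&-T_{\nu-2}&\cdots&-T_1\end{bmatrix}$$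 with $r\times r$ blocks; this defines $T_1,\dots,T_\nu$. The $l\times r$ matrices $C_1,\dots,C_\nu$ are defined by the partition $CN^{-1}=[C_1,C_2,\dots,C_\nu]$. *)

(* Defs.v *)
From HB Require Import structures.
From mathcomp Require Import all_boot all_order all_algebra.
From mathcomp Require Import reals.

Set Implicit Arguments.
Unset Strict Implicit.
Unset Printing Implicit Defensive.

Import GRing.Theory.
Local Open Scope ring_scope.

(* Matrices made of k blocks of width (or height) r have the library dimension
   \sum_(i < k) r; it is identified with n through castmx. *)
Lemma block_dim (n r nu : nat) : n = (r * nu)%N -> (\sum_(i < nu) r)%N = n.
Proof. by move=> ->; rewrite sum_nat_const card_ord mulnC. Qed.

Section Controllability.
Variables (R : fieldType) (n r : nat) (A : 'M[R]_n) (B : 'M[R]_(n, r)).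

(* [B, AB, ..., A^(k-1) B] *)
Definition ctrb_mx (k : nat) : 'M[R]_(n, \sum_(i < k) r) :=
  \mxrow_(i < k) (A ^+ i *m B).

Definition controllable : Prop := \rank (ctrb_mx n) = n.

Definition is_controllability_index (nu : nat) : Prop :=
  \rank (ctrb_mx nu) = \rank (ctrb_mx n) /\
  forall k : nat, \rank (ctrb_mx k) = \rank (ctrb_mx n) -> (nu <= k)%N.

End Controllability.

Section AsseoForm.
Variables (R : fieldType) (n r l nu : nat).
Variables (e : (\sum_(i < nu) r)%N = n).
Variables (A : 'M[R]_n) (B : 'M[R]_(n, r)) (C : 'M[R]_(l, n)).

(* [O, ..., O, I_r] *)
Definition last_block_mx : 'M[R]_(r, n) :=
  castmx (erefl r, e) (\mxrow_(i < nu) (if i.+1 == nu then 1%:M else 0)).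

(* N_nu = [O, ..., O, I_r] [B, AB, ..., A^(nu-1) B]^-1 *)
Definition asseo_row : 'M[R]_(r, n) :=
  last_block_mx *m invmx (castmx (erefl n, e) (ctrb_mx A B nu)).

(* block rows N_nu, N_nu A, ..., N_nu A^(nu-1) *)
Definition asseo_mx : 'M[R]_n :=
  castmx (e, erefl n) (\mxcol_(i < nu) (asseo_row *m A ^+ i)).

Definition asseo_form : 'M[R]_n := asseo_mx *m A *m invmx asseo_mx.

(* asseo_T k is T_(k+1). Multiplying A^* on the left by [O, ..., O, I_r] gives
   its last block row [-T_nu, ..., -T_1], where T_(k+1) occupies block column
   nu - 1 - k, counted from 0. *)
Definition asseo_T (k : 'I_nu) : 'M[R]_r :=
  - submxrow (castmx (erefl r, esym e) (last_block_mx *m asseo_form))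
             (rev_ord k).

(* asseo_C j is C_(j+1). *)
Definition asseo_C (j : 'I_nu) : 'M[R]_(l, r) :=
  submxrow (castmx (erefl l, esym e) (C *m invmx asseo_mx)) j.

(* C(s) = C_1 + C_2 s + ... + C_nu s^(nu-1), with s = 'X *)
Definition asseo_num : 'M[{poly R}]_(l, r) :=
  \sum_(j < nu) 'X^j *: map_mx polyC (asseo_C j).

(* T_nu + T_(nu-1) s + ... + T_1 s^(nu-1) + I_r s^nu; the coefficient of s^j
   is T_(nu-j), that is, asseo_T at index nu - 1 - j. *)
Definition asseo_den : 'M[{poly R}]_r :=
  \sum_(j < nu) 'X^j *: map_mx polyC (asseo_T (rev_ord j)) + ('X^nu)%:M.

End AsseoForm.

(* A polynomial matrix viewed over the field R(s) of rational functions. *)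
Definition rat_mx (R : fieldType) (p q : nat) (M : 'M[{poly R}]_(p, q)) :
  'M[{fraction {poly R}}]_(p, q) := map_mx (@FracField.tofrac {poly R}) M.

(* G(s) = C (s I_n - A)^-1 B *)
Definition transfer_mx (R : fieldType) (n r l : nat)
    (A : 'M[R]_n) (B : 'M[R]_(n, r)) (C : 'M[R]_(l, n)) :
  'M[{fraction {poly R}}]_(l, r) :=
  rat_mx (map_mx polyC C) *m invmx (rat_mx ('X%:M - map_mx polyC A))
    *m rat_mx (map_mx polyC B).

(* Main.v *)
(* Put X = [I; s I; ...; s^(nu-1) I].  The blocks of N_nu [B, ..., A^(nu-1) B]
   give N_nu A^i B = 0 for i < nu - 1 and N_nu A^(nu-1) B = I, so N is
   invertible.  Block row i of N (s I - A) N^-1 X is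
   s^(i+1) I - N_nu A^(i+1) N^-1 X, which is 0 except in the last block, where
   it is A_2^*(s); hence (s I - A) N^-1 X = B A_2^*(s).  Multiplying by
   C (s I - A)^-1 gives G(s) A_2^*(s) = C N^-1 X = C(s). *)
Require Import Defs.
From HB Require Import structures.
From mathcomp Require Import all_boot all_order all_algebra.
From mathcomp Require Import reals zify.

Set Implicit Arguments.
Unset Strict Implicit.
Unset Printing Implicit Defensive.

Import GRing.Theory.
Local Open Scope ring_scope.

Lemma submxcol_map (S T : Type) (f : S -> T) (nu r p : nat)
    (M : 'M[S]_(\sum_(i < nu) r, p)) (i : 'I_nu) :
  submxcol (map_mx f M) i = map_mx f (submxcol M i).
Proof. by apply/matrixP => a b; rewrite !mxE. Qed.

Lemma submxrow_map (S T : Type) (f : S -> T) (nu r p : nat)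
    (M : 'M[S]_(p, \sum_(i < nu) r)) (i : 'I_nu) :
  submxrow (map_mx f M) i = map_mx f (submxrow M i).
Proof. by apply/matrixP => a b; rewrite !mxE. Qed.

Section Asseo.
Variables (R : fieldType) (r nu : nat).
Local Notation n := (\sum_(i < nu) r)%N.
Variables (A : 'M[R]_n) (B : 'M[R]_(n, r)).
Hypothesis ctrb_unit : ctrb_mx A B nu \in unitmx.
Local Notation e := (erefl n).
Local Notation Nrow := (asseo_row e A B).
Local Notation N := (asseo_mx e A B).

Lemma asseo_row_ctrb (i : 'I_nu) :
  Nrow *m (A ^+ i *m B) = if i.+1 == nu then 1%:M else 0.
Proof.
have -> : A ^+ i *m B = submxrow (ctrb_mx A B nu) i by rewrite mxrowK.
by rewrite mul_submxrow /asseo_row !castmx_id mulmxKV // /last_block_mx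
           castmx_id mxrowK.
Qed.

Lemma submxcol_asseo_mx (i : 'I_nu) : submxcol N i = Nrow *m A ^+ i.
Proof. by rewrite /asseo_mx castmx_id mxcolK. Qed.

(** Since [asseo_form] is N A N^-1, this gives its last block row as N_nu A^(nu-1) A N^-1, the row
    from which the T_k are read. *)
Lemma last_block_asseo_mx : last_block_mx R e *m N = Nrow *m A ^+ nu.-1.
Proof.
rewrite /last_block_mx /asseo_mx !castmx_id mul_mxrow_mxcol.
case: (posnP nu) => [nu0|nu_gt0].
  apply/matrixP=> a b; exfalso.
  by case: b => b; rewrite nu0 big_ord0.
have lt_nu : (nu.-1 < nu)%N by rewrite prednK.
rewrite [LHS](bigD1 (Ordinal lt_nu)) //= (introT eqP (prednK nu_gt0)) mul1mx.
rewrite [X in _ + X]big1 ?addr0 // => i; rewrite -val_eqE /= => ne_i.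
suff /negPf-> : i.+1 != nu by rewrite mul0mx.
by apply: contra ne_i => /eqP {2}<-.
Qed.

(* N [B, AB, ..., A^(nu-1) B] is block anti-triangular with identity blocks on
   the antidiagonal, so the blocks of a row vector killed by N vanish one by
   one, starting with the last. *)
Lemma asseo_mx_unit : N \in unitmx.
Proof.
rewrite -row_free_unit; apply: inj_row_free => v vN0.
apply/mxrowP => i; rewrite submxrow0.
have vNA k : \sum_j submxrow v j *m (Nrow *m (A ^+ (j + k) *m B)) = 0.
  transitivity (v *m N *m (A ^+ k *m B)); last by rewrite vN0 mul0mx.
  rewrite -[in RHS](submxrowK v) /asseo_mx castmx_id mul_mxrow_mxcol mulmx_suml.
  by apply: eq_bigr => j _; rewrite exprD -mulmxE !mulmxA.
(* Descending induction on the block index, run on a bound m for nu - i. *)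
move: {2}(nu - i)%N (leqnn (nu - i)) => m.
elim: m i => [|m IHm] i; first by rewrite leqNgt subn_gt0 ltn_ord.
move=> le_m.
(* The shift k = nu - 1 - i brings block i to the exponent nu - 1, where N_nu A^(nu-1) B = I. Blocks
   j < i stay below that exponent and give 0; blocks j > i vanish by induction. *)
have vA0 j : j != i ->
    submxrow v j *m (Nrow *m (A ^+ (j + (nu - i.+1)) *m B)) = 0.
  case: (ltngtP j i) => [lt_ji _|lt_ij _|/val_inj-> /eqP//].
    have lt_nu : (j + (nu - i.+1) < nu)%N by have := ltn_ord i; lia.
    rewrite (asseo_row_ctrb (Ordinal lt_nu)) /=.
    by case: eqP => [|_]; [have := ltn_ord i; lia | rewrite mulmx0].
  by rewrite IHm ?mul0mx //; lia.
have lt_nu : (i + (nu - i.+1) < nu)%N by have := ltn_ord i; lia.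
rewrite -[RHS](vNA (nu - i.+1)%N) [RHS](bigD1 i) //= [X in _ + X]big1 // addr0.
rewrite (asseo_row_ctrb (Ordinal lt_nu)) /= -addnS subnSK // subnKC 1?ltnW //.
by rewrite eqxx mulmx1.
Qed.

Definition monomial_mx : 'M[{poly R}]_(n, r) := \mxcol_(i < nu) ('X^i)%:M.

Lemma map_mul_monomial_mx (p : nat) (M : 'M[R]_(p, n)) :
  map_mx polyC M *m monomial_mx =
  \sum_(j < nu) 'X^j *: map_mx polyC (submxrow M j).
Proof.
rewrite -[in LHS](submxrowK (map_mx _ M)) mul_mxrow_mxcol.
by apply: eq_bigr => j _; rewrite submxrow_map mul_mx_scalar.
Qed.

Lemma asseo_numE (l : nat) (C : 'M[R]_(l, n)) :
  asseo_num e A B C = map_mx polyC (C *m invmx N) *m monomial_mx.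
Proof.
rewrite map_mul_monomial_mx; apply: eq_bigr => j _.
by rewrite /asseo_C castmx_id.
Qed.

Lemma asseo_denE :
  asseo_den e A B = ('X^nu)%:M
    - map_mx polyC (Nrow *m A ^+ nu.-1 *m A *m invmx N) *m monomial_mx.
Proof.
rewrite map_mul_monomial_mx addrC -sumrN; congr (_ + _).
apply: eq_bigr => j _; rewrite -scalerN -map_mxN /asseo_T rev_ordK castmx_id.
by rewrite /asseo_form !mulmxA last_block_asseo_mx.
Qed.

Lemma char_poly_mx_asseo :
  ('X%:M - map_mx polyC A) *m (map_mx polyC (invmx N) *m monomial_mx) =
  map_mx polyC B *m asseo_den e A B.
Proof.
have uN := asseo_mx_unit.
have uNp : map_mx polyC N \in unitmx.
  by rewrite unitmxE det_map_mx rmorph_unit // -unitmxE.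
(* As N is invertible, it is enough to compare block rows after multiplying by N on the left. *)
apply: (can_inj (mulKmx uNp)); apply/mxcolP => i.
rewrite -!submxcol_mul !submxcol_map submxcol_asseo_mx.
(* Block j of the identity N N^-1 X = X. *)
have NX (j : 'I_nu) :
    map_mx polyC (Nrow *m A ^+ j *m invmx N) *m monomial_mx = ('X^j)%:M.
  rewrite -submxcol_asseo_mx submxcol_mul mulmxV // -submxcol_map map_mx1.
  by rewrite submxcol_mul mul1mx mxcolK.
rewrite mulmxBl mulmxBr.
have -> : map_mx polyC (Nrow *m A ^+ i)
     *m ('X%:M *m (map_mx polyC (invmx N) *m monomial_mx)) = ('X^(i.+1))%:M.
  rewrite mul_scalar_mx -scalemxAr mulmxA -map_mxM NX.
  by rewrite scale_scalar_mx exprS.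
rewrite !mulmxA -!map_mxM -[_ *m B]mulmxA asseo_row_ctrb.
(* The last block is [asseo_denE]. In any other, N_nu A^(i+1) is again a block row of N, so [NX]
   makes the difference vanish. *)
case: eqP => [nuE|/eqP ne_nu].
  by rewrite map_mx1 mul1mx asseo_denE [in 'X^_]nuE (_ : nu.-1 = i) //; lia.
rewrite map_mx0 mul0mx.
have lt_i : (i.+1 < nu)%N by rewrite ltn_neqAle ne_nu ltn_ord.
have := NX (Ordinal lt_i); rewrite /= exprSr -mulmxE mulmxA => ->.
by rewrite subrr.
Qed.

(** The denominator is kept on the left, not inverted, so that the instance C = N can serve to prove
    it invertible. *)
Lemma transfer_mx_mul_den (l : nat) (C : 'M[R]_(l, n)) :
  transfer_mx A B C *m rat_mx (asseo_den e A B) =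
  rat_mx (map_mx polyC (C *m invmx N) *m monomial_mx).
Proof.
have uG : rat_mx ('X%:M - map_mx polyC A) \in unitmx.
  rewrite unitmxE det_map_mx unitfE tofrac_eq0.
  exact: monic_neq0 (char_poly_monic A).
rewrite /transfer_mx -[LHS]mulmxA -[in LHS]map_mxM -char_poly_mx_asseo.
rewrite [in LHS]map_mxM mulmxA mulmxKV // -[LHS]map_mxM.
by rewrite mulmxA -map_mxM.
Qed.

(* The top block of N (s I - A)^-1 B A_2^*(s) = X is I_r, which exhibits a left
   inverse of A_2^*(s). *)
Lemma asseo_den_unit : rat_mx (asseo_den e A B) \in unitmx.
Proof.
case: (posnP nu) => [nu0|nu_gt0].
  (* For nu = 0 the sum is empty and only X^0 = 1 remains. *)
  have -> : asseo_den e A B = 1%:M; last by rewrite [rat_mx _]map_mx1 unitmx1.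
  rewrite /asseo_den big1 ?add0r => [|j _]; first by rewrite [in 'X^_]nu0.
  by have := ltn_ord j; rewrite [X in (_ < X)%N]nu0.
have := transfer_mx_mul_den N; rewrite mulmxV ?asseo_mx_unit // map_mx1 mul1mx.
move/(congr1 (fun M => submxcol M (Ordinal nu_gt0))).
rewrite -submxcol_mul submxcol_map mxcolK expr0 map_mx1.
by case/mulmx1_unit.
Qed.

Lemma transfer_mx_factor (l : nat) (C : 'M[R]_(l, n)) :
  transfer_mx A B C =
  rat_mx (asseo_num e A B C) *m invmx (rat_mx (asseo_den e A B)).
Proof.
by rewrite asseo_numE -transfer_mx_mul_den mulmxK // asseo_den_unit.
Qed.

End Asseo.

Theorem mainTheorem1 (R : realType) (n r l nu : nat)
    (A : 'M[R]_n) (B : 'M[R]_(n, r)) (C : 'M[R]_(l, n))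
    (rankB : \rank B = r)
    (ctrlAB : controllable A B)
    (index_nu : is_controllability_index A B nu)
    (dim_n : n = (r * nu)%N) :
  let e := block_dim dim_n in
  rat_mx (asseo_den e A B) \in unitmx /\
  transfer_mx A B C =
    rat_mx (asseo_num e A B C) *m invmx (rat_mx (asseo_den e A B)).
Proof.
case: index_nu => rank_nu _; rewrite ctrlAB in rank_nu.
(* Once the dimension equality is an arbitrary [e], eliminating it makes n literally the block sum,
   and every [castmx] becomes the identity. *)
move: (block_dim dim_n) => e /=; clear dim_n rankB ctrlAB.
case: _ / e in A B C rank_nu *.
have ctrb_unit : ctrb_mx A B nu \in unitmx.
  by rewrite -row_full_unit /row_full rank_nu.
by split; [exact: asseo_den_unit | exact: transfer_mx_factor].
Qed.
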